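(* Let $P=[b_1,\ldots,b_N,\overline{a_1,\ldots,a_k}]$ be a periodic continued fraction with $N\ge0$, $k\ge1$ and $b_i,a_i\in\mathbb{C}$. Extend the $a_i$ periodically by $a_{i+k}=a_i$ for all $i\ge1$. Then the value $\hat\beta(P)\in\mathbb{P}^1(\mathbb{C})$ exists if and only if none of the following three conditions is satisfied: (1) $E(P)=\pm i^k I$ (where $i=\sqrt{-1}$ and $I$ is the $2\times2$ identity matrix). (2) For some $0\le j\le k-1$, $M([a_{j+1},\ldots,a_{k+j}])_{21}=0$ and $\left|M([a_{j+1},\ldots,a_{k+j}])_{22}\right|>1$. (3) $\operatorname{Tr}(E(P))^2\in\mathbb{R}$ and $0\le(-1)^k\operatorname{Tr}(E(P))^2<4$. If $P$ converges, then its value is $\hat\beta(P)=\beta_+(E(P))$.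
   Context: Put $D(c)=\begin{bmatrix}c&1\\1&0\end{bmatrix}$ and $M([c_1,\ldots,c_n])=D(c_1)\cdots D(c_n)$ (the identity if $n=0$). The infinite periodic continued fraction $[b_1,\ldots,b_N,\overline{a_1,\ldots,a_k}]$ is the sequence $[c_1,c_2,c_3,\ldots]$ of partial quotients $b_1,\ldots,b_N,a_1,\ldots,a_k,a_1,\ldots,a_k,\ldots$. Its $n$-th convergent is $[c_1,\ldots,c_n]=M([c_1,\ldots,c_n])_{11}/M([c_1,\ldots,c_n])_{21}\in\mathbb{P}^1(\mathbb{C})$, and its value $\hat\beta(P)$ is the limit of the convergents in $\mathbb{P}^1(\mathbb{C})$ as $n\to\infty$, if it exists (convergence to $\infty$ is allowed); $P$ converges if the value exists. Set $$E(P)=M([b_1,\ldots,b_N])\,M([a_1,\ldots,a_k])\,M([b_1,\ldots,b_N])^{-1},$$ so $\det E(P)=(-1)^k$. For a complex matrix $A=\begin{bmatrix}a&b\\c&d\end{bmatrix}$ with $ad-bc=\varepsilon=\pm1$, let $\lambda_\pm$ be its eigenvalues, labelled so that $|\lambda_+|\ge1\ge|\lambda_-|$. If $A\ne\pm\sqrt{\varepsilon}\,I$, let $\beta_\pm(A)=\dfrac{\lambda_\pm-d}{c}=\dfrac{b}{\lambda_\pm-a}\ \left(=\dfrac{a-\lambda_\mp}{c}=\dfrac{b}{d-\lambda_\mp}\right)\in\mathbb{P}^1(\mathbb{C})$, taking whichever expression is not the indeterminate $0/0$. *)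

(* Defs.v *)
From HB Require Import structures.
From mathcomp Require Import all_boot all_order all_algebra.
From mathcomp Require Import all_classical all_reals all_analysis.
From mathcomp Require Import complex.
From mathcomp Require Import ring.

Set Implicit Arguments.
Unset Strict Implicit.
Unset Printing Implicit Defensive.

Import Order.TTheory GRing.Theory Num.Theory.
Import numFieldNormedType.Exports.

Local Open Scope classical_set_scope.
Local Open Scope ring_scope.

(* P^1(C) = C u {oo} as a topological space: [Some z] is the point z = [z : 1]
   and [None] is oo = [1 : 0].  The regular algebra R[i]^o carries the usual
   topology of C (the one of the modulus). *)
Definition P1 (R : realType) : Type := one_point_compactification R[i]^o.

(* The point [x : y]; meaningful only for (x, y) <> (0, 0). *)
Definition P1_ratio (R : realType) (x y : R[i]) : P1 R :=
  if y == 0 then None else Some (x / y).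

Lemma det22 (S : comPzRingType) (A : 'M[S]_2) :
  \det A = A 0 0 * A 1 1 - A 0 1 * A 1 0.
Proof.
rewrite (expand_det_row _ 0) !big_ord_recl big_ord0 addr0 /cofactor.
rewrite !det_mx11 !mxE /= expr0 mul1r expr1 mulN1r mulrN.
by congr (A _ _ * A _ _ - A _ _ * A _ _); exact: val_inj.
Qed.

Section ContinuedFractions.
Variable R : realType.
Implicit Types (b a s : seq R[i]) (A : 'M[R[i]]_2).

(* [[c, 1], [1, 0]] *)
Definition Dmx (c : R[i]) : 'M[R[i]]_2 :=
  \matrix_(i < 2, j < 2)
    if i == 0 then (if j == 0 then c else 1) else (if j == 0 then 1 else 0).

Definition Mmx s : 'M[R[i]]_2 := \prod_(c <- s) Dmx c.

(* Indices are shifted by one: [periodic_ext a i] is a_(i+1), and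
   [partial_quotient b a n] is c_(n+1). *)
Definition periodic_ext a (i : nat) : R[i] := a`_(i %% size a).

Definition partial_quotient b a (n : nat) : R[i] :=
  if (n < size b)%N then b`_n else periodic_ext a (n - size b).

(* [c_1, ..., c_n]; the entries cannot both vanish since
   \det (Mmx s) = (-1) ^+ size s. *)
Definition convergent b a (n : nat) : P1 R :=
  let M := Mmx (mkseq (partial_quotient b a) n) in P1_ratio (M 0 0) (M 1 0).

Definition has_value b a (v : P1 R) : Prop :=
  convergent b a n @[n --> \oo] --> v.

Definition Emx b a : 'M[R[i]]_2 := Mmx b * Mmx a * (Mmx b)^-1.

(* [a_(j+1), ..., a_(k+j)] with k = size a *)
Definition period_from a (j : nat) : seq R[i] :=
  mkseq (fun i => periodic_ext a (j + i)) (size a).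

(* lp, lm are the eigenvalues of A, with multiplicity, labelled so that
   |lp| >= 1 >= |lm|.  When all moduli are 1 both labellings are allowed. *)
Definition eigenvalue_labelling A (lp lm : R[i]) : Prop :=
  [/\ char_poly A = ('X - lp%:P) * ('X - lm%:P), 1 <= `|lp| & `|lm| <= 1].

(* The point beta of A = [[a, b], [c, d]] at the eigenvalue l:
   (l - d) / c, or b / (l - a) if the former is 0/0.  The latter is then 0/0
   only when A is the scalar matrix l%:M. *)
Definition beta A (l : R[i]) : P1 R :=
  if (l - A 1 1 == 0) && (A 1 0 == 0) then P1_ratio (A 0 1) (l - A 0 0)
  else P1_ratio (l - A 1 1) (A 1 0).

Lemma det_Dmx c : \det (Dmx c) = -1.
Proof. by rewrite det22 !mxE /= mulr0 mulr1 add0r. Qed.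

Lemma det_Mmx s : \det (Mmx s) = (-1) ^+ size s.
Proof.
rewrite /Mmx; elim: s => [|c s IHs]; first by rewrite big_nil det1.
by rewrite big_cons det_mulmx det_Dmx IHs exprS.
Qed.

Lemma Mmx_unit s : Mmx s \is a GRing.unit.
Proof. by rewrite -[_ \is a _]/(_ \in unitmx) unitmxE det_Mmx unitrX ?unitrN1. Qed.

Lemma det_Emx b a : \det (Emx b a) = (-1) ^+ size a.
Proof.
rewrite /Emx !det_mulmx det_inv !det_Mmx mulrAC divff ?mul1r //.
by rewrite expf_neq0 // oppr_eq0 oner_eq0.
Qed.

Lemma eigenvalue_labelling_exists A :
  `|\det A| = 1 -> exists lp lm, eigenvalue_labelling A lp lm.
Proof.
move=> detA; set t := \tr A; set d := \det A.
have [s sE] : {s | s ^+ 2 = t ^+ 2 - 4 * d}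
    by exists (sqrtC (t ^+ 2 - 4 * d)); rewrite sqrtCK.
pose l1 := (t + s) / 2; pose l2 := (t - s) / 2.
have sumE : l1 + l2 = t by rewrite /l1 /l2; field.
have prodE : l1 * l2 = d.
  transitivity ((t ^+ 2 - s ^+ 2) / 4); first by rewrite /l1 /l2; field.
  by rewrite sE; field.
move: l1 l2 sumE prodE => l1 l2 sumE prodE.
have chiE : char_poly A = ('X - l1%:P) * ('X - l2%:P).
  have -> : ('X - l1%:P) * ('X - l2%:P)
            = 'X * 'X - (l1 + l2)%:P * 'X + (l1 * l2)%:P.
    rewrite polyCD polyCM; move: l1%:P l2%:P => p q.
    by ring.
  rewrite sumE prodE /t /d /char_poly !det22 !mxE /= mulr1n mulr0n.
  rewrite /mxtrace big_ord_recl big_ord1.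
  rewrite (_ : lift ord0 ord0 = 1 :> 'I_2); last exact: val_inj.
  rewrite polyCB !polyCM !polyCD !sub0r.
  move: (A 0 0)%:P (A 0 1)%:P (A 1 0)%:P (A 1 1)%:P => p q r u.
  by ring.
have normE : `|l1| * `|l2| = 1 by rewrite -normrM prodE.
have cmp (x y : R[i]) : 0 <= x -> 0 <= y -> x * y = 1 -> 1 <= x -> y <= 1.
  move=> x0 y0 xy x1; rewrite -xy -[leLHS]mul1r.
  exact: ler_wpM2r.
have [h|h] := real_leP (ger0_real ler01) (normr_real l1).
  by exists l1, l2; split => //; apply: (cmp _ _ _ _ normE).
exists l2, l1; split; [by rewrite mulrC| |exact: ltW].
rewrite -normE -[leRHS]mul1r; apply: ler_wpM2r => //; exact: ltW.
Qed.

End ContinuedFractions.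

(* Main.v *)
(* Consecutive convergents are the two columns, taken in P^1, of an invertible
   matrix, and along each residue class mod k they form an orbit E^m w of E = E(P).
   Any limit of such an orbit is an eigenline of E.

   Necessity.  If the limit is the eigenline of mu and the other eigenvalue nu
   satisfies |mu| <= |nu| and mu <> nu, then every w lies on that eigenline; two
   consecutive w would then be collinear.  A scalar E is excluded in the same way.
   (2) says that some w lies on the eigenline of the smaller eigenvalue, and (3)
   that the eigenvalues are distinct and of equal modulus.

   Sufficiency.  If |lp| > |lm|, then lp^-m E^m w tends to a multiple of
   (E - lm) w, nonzero because (2) fails; if lp = lm, the orbit tends to the
   line of (E - lp) w, or is constant. *)
Require Import Defs.
From mathcomp Require Import all_boot all_order all_algebra.
From mathcomp Require Import all_classical all_reals all_analysis.
From mathcomp Require Import complex ring.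
Import Order.TTheory GRing.Theory Num.Theory.
Import numFieldNormedType.Exports.
Local Open Scope ring_scope.
Local Open Scope classical_set_scope.

Set Implicit Arguments.
Unset Strict Implicit.
Unset Printing Implicit Defensive.

(* A [Variant] rather than a [Definition], so that the underlying filter
   inclusion never shows up as extra arguments during unification. *)
Variant tends_to (K : numFieldType) (u : nat -> K) (l : K) : Prop :=
  TendsTo of u n @[n --> \oo] --> l.

(** * Limits of scalar sequences *)

Section Sequences.
Variable K : numFieldType.
Implicit Types (u v : nat -> K) (a b l : K).

Lemma tends_toP u l :
  tends_to u l <-> forall e : K, 0 < e -> \forall n \near \oo, `|l - u n| < e.
Proof. by split=> [[/cvgrPdist_lt]|ul] //; split; exact/cvgrPdist_lt. Qed.

Lemma tends_to_unique u a b : tends_to u a -> tends_to u b -> a = b.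
Proof. by move=> [ua] [ub]; apply: cvg_unique ua ub; exact: norm_hausdorff. Qed.

Lemma tends_to_cst a : tends_to (fun=> a) a.
Proof. by split; exact: cvg_cst. Qed.

Lemma tends_toD u v a b :
  tends_to u a -> tends_to v b -> tends_to (fun n => u n + v n) (a + b).
Proof. by move=> [ua] [vb]; split; exact: cvgD. Qed.

Lemma tends_toM u v a b :
  tends_to u a -> tends_to v b -> tends_to (fun n => u n * v n) (a * b).
Proof. by move=> [ua] [vb]; split; exact: cvgM. Qed.

Lemma tends_toV u a : a != 0 -> tends_to u a -> tends_to (fun n => (u n)^-1) a^-1.
Proof. by move=> a0 [ua]; split; exact: cvgV. Qed.

Lemma tends_to_neq0 u a : a != 0 -> tends_to u a -> \forall n \near \oo, u n != 0.
Proof. by move=> a0 [/cvgr_neq0]; apply. Qed.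

Lemma near_tends_to u v a :
  (\forall n \near \oo, u n = v n) -> tends_to u a -> tends_to v a.
Proof. by move=> uv [ua]; split; apply: cvg_trans ua; exact: near_eq_cvg. Qed.

Lemma eq_tends_to u v a : u =1 v -> tends_to u a -> tends_to v a.
Proof. by move=> uv; apply: near_tends_to; exact: nearW. Qed.

Lemma tends_to_sub (f : nat -> nat) u a :
  (forall n, n <= f n)%N -> tends_to u a -> tends_to (u \o f) a.
Proof.
move=> fn [ua]; split; apply: cvg_comp ua.
move=> A [N _ NA]; exists N => // n /= Nn; apply: NA => /=.
exact: leq_trans (fn n).
Qed.

(** There are finitely many residue classes mod [k], so the orbits of [E] can be treated one at a
    time. *)
Lemma near_residues (P : nat -> Prop) (k : nat) : (0 < k)%N ->
  (forall j, (j < k)%N -> \forall m \near \oo, P (j + m * k)%N) ->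
  \forall n \near \oo, P n.
Proof.
move=> k0 Pj.
have {Pj}Pj (j : 'I_k) : {N | forall m, (N <= m)%N -> P (j + m * k)%N}.
  by apply: cid; have [N _ NP] := Pj j (ltn_ord j); exists N.
(* For n = j + m k, the bound n >= N_j k gives m >= N_j. *)
exists (\max_j (sval (Pj j)) * k)%N => // n /= n_ge.
rewrite (divn_eq n k) addnC.
have jk : (n %% k < k)%N by rewrite ltn_mod.
apply: (svalP (Pj (Ordinal jk))).
rewrite leq_divRL //; apply: leq_trans n_ge.
exact: (@leq_bigmax _ (fun j => sval (Pj j) * k)%N (Ordinal jk)).
Qed.

End Sequences.

(** * Neighbourhoods in the Riemann sphere *)

Section ComplexTopology.
Variable R : realType.
Local Notation C := R[i].

(** Transports compactness from products of real segments to squares in C. *)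
Definition complex_of_pair (p : R * R) : C^o := (p.1 +i* p.2)%C.

Lemma normc_le_add (x y : R) : `|(x +i* y)%C| <= (`|x| + `|y|)%:C%C.
Proof.
have -> : (x +i* y)%C = x%:C%C + y%:C%C * 'i%C by simpc.
rewrite (le_trans (ler_normD _ _)) // normrM.
have -> : `|'i%C| = 1 :> C by rewrite normc_def /= expr0n expr1n add0r sqrtr1.
by rewrite mulr1 !normc_def /= expr0n !addr0 !sqrtr_sqr rmorphD.
Qed.

Lemma gt0_complex (e : C) : 0 < e -> exists2 r : R, 0 < r & e = r%:C%C.
Proof.
move=> e0; have /complex_realP[r er] : e \is Num.real by exact: gtr0_real.
by exists r => //; move: e0; rewrite er ltcR.
Qed.

Lemma complex_of_pair_continuous : continuous complex_of_pair.
Proof.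
move=> [x y]; apply/cvgrPdist_lt => e /gt0_complex[r r0 ->].
have r2 : 0 < r / 2 by rewrite divr_gt0.
near=> p.
rewrite (_ : _ - _ = ((x - p.1) +i* (y - p.2))%C) //.
rewrite (le_lt_trans (normc_le_add _ _)) // ltcR (splitr r) ltrD //.
  near: p; apply: (@cvgr_dist_lt _ _ _ _ _ fst x) => //; exact: cvg_fst.
near: p; apply: (@cvgr_dist_lt _ _ _ _ _ snd y) => //; exact: cvg_snd.
Unshelve. all: by end_near. Qed.

Lemma normc_ge_Re_Im (x y : R) :
  `|x|%:C%C <= `|(x +i* y)%C| /\ `|y|%:C%C <= `|(x +i* y)%C|.
Proof.
rewrite normc_def /= !lecR -!sqrtr_sqr.
by split; apply: ler_wsqrtr; rewrite ?lerDl ?lerDr sqr_ge0.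
Qed.

(** The modulus has type [R[i]]; this version in [R] gives access to real boundedness and real
    geometric sequences. *)
Definition normr_val (z : C) : R := complex.Re `|z|.

Lemma normr_valE (z : C) : (normr_val z)%:C%C = `|z|.
Proof. by rewrite /normr_val RRe_real. Qed.

Lemma normr_val_ge0 (z : C) : 0 <= normr_val z.
Proof. by rewrite -ler0c normr_valE. Qed.

Lemma normr_real_complex (x : R) : `|x%:C%C| = `|x|%:C%C.
Proof. by rewrite normc_def /= expr0n addr0 sqrtr_sqr. Qed.

Lemma complex_compact_bounded (A : set C^o) :
  compact A -> exists r : R, forall z : C, A z -> `|z| <= r%:C%C.
Proof.
move=> cA.
have cn : continuous (normr_val : C^o -> R).
  move=> z; apply/(@cvgrPdist_lt _ _ _ _ (nbhs_filter (z : C^o))) => e e0.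
  have e0' : 0 < e%:C%C by rewrite ltcR.
  near=> w.
  have zw : (`|(z : C) - (w : C)| : C) < e%:C%C.
    by near: w; exists e%:C%C.
  rewrite -ltcR; apply: le_lt_trans zw; apply: le_trans (ler_dist_dist _ _).
  by rewrite -(normr_valE z) -(normr_valE w) -rmorphB normr_real_complex.
have /compact_bounded [M [_ Mb]] :=
  continuous_compact (continuous_subspaceT (A := A) cn) cA.
exists (M + 1) => z Az.
have M1 : M < M + 1 by rewrite ltrDl.
have := Mb _ M1 _ (imageP normr_val Az).
by rewrite -normr_valE lecR; exact/le_trans/ler_norm.
Unshelve. all: by end_near. Qed.

Lemma complex_square_compact (r : R) :
  compact [set complex_of_pair p | p in `[- r, r] `*` `[- r, r]].
Proof.
apply: continuous_compact; last by apply: compact_setX; exact: segment_compact.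
exact/continuous_subspaceT/complex_of_pair_continuous.
Qed.

Lemma near_Some (z : C) (P : P1 R -> Prop) :
  nbhs (Some z : P1 R) P <->
  exists2 e : C, 0 < e & forall w : C, `|z - w| < e -> P (Some w).
Proof.
split=> [[e e0 eP]|[e e0 eP]]; first by exists e => // w; exact: eP.
by exists e.
Qed.

(** Neighbourhoods of oo contain complements of closed compact sets. One direction bounds such a
    set, the other removes a large square. *)
Lemma near_None (P : P1 R -> Prop) :
  nbhs (None : P1 R) P <->
  P None /\ exists r : R, forall w : C, r%:C%C < `|w| -> P (Some w).
Proof.
split=> [[A [cA _] AP]|[PN [r rP]]].
  split; first by apply: AP; right.
  have [r Ar] := complex_compact_bounded cA.
  exists r => w rw; apply: AP; left; exists w => // /Ar.
  by move=> /(lt_le_trans rw); rewrite ltxx.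
(* Outside this square some coordinate exceeds |r| + 1 in absolute value, so the modulus exceeds r,
   whatever the sign of r. *)
exists [set complex_of_pair p |
    p in `[- (`|r| + 1), `|r| + 1] `*` `[- (`|r| + 1), `|r| + 1]].
  split; first exact: complex_square_compact.
  apply: (@compact_closed C^o); last exact: complex_square_compact.
  exact: norm_hausdorff.
move=> _ [[w nAw <-]|-> //]; apply: rP.
case: w nAw => x y /= nA.
have r1 : (r < `|r| + 1) by rewrite (le_lt_trans (ler_norm _)) // ltrDl.
have [xr yr] := normc_ge_Re_Im x y.
have [xb|xb] := leP `|x| (`|r| + 1); last first.
  by apply: lt_le_trans xr; rewrite ltcR (lt_trans r1).
have [yb|yb] := leP `|y| (`|r| + 1); last first.
  by apply: lt_le_trans yr; rewrite ltcR (lt_trans r1).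
by case: nA; exists (x, y) => //; split; rewrite /= in_itv /= -ler_norml.
Qed.

End ComplexTopology.

(** * Eigenvectors and Cayley-Hamilton for 2 x 2 matrices *)

Section Matrices2.
Variable K : fieldType.
Implicit Types (A : 'M[K]_2) (p q w : 'cV[K]_2) (mu nu : K).

Lemma mulmx2E m (A : 'M[K]_2) (B : 'M[K]_(2, m)) i j :
  (A *m B) i j = A i 0 * B 0 j + A i 1 * B 1 j.
Proof.
rewrite mxE !big_ord_recl big_ord0 addr0.
by congr (_ + A _ _ * B _ _); exact: val_inj.
Qed.

Lemma ord2P (i : 'I_2) : i = 0 \/ i = 1.
Proof. by case: i => -[|[|//]] h; [left|right]; exact: val_inj. Qed.

Lemma cV2P p q : p 0 0 = q 0 0 -> p 1 0 = q 1 0 -> p = q.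
Proof.
by move=> e0 e1; apply/colP => i; case: (ord2P i) => ->.
Qed.

Lemma cV2_neq0 p : p != 0 -> (p 0 0 != 0) || (p 1 0 != 0).
Proof.
apply: contraNT; rewrite negb_or !negbK => /andP[/eqP p0 /eqP p1].
by apply/eqP/cV2P; rewrite mxE.
Qed.

Lemma collinear_eigen p q : p != 0 -> p 0 0 * q 1 0 = p 1 0 * q 0 0 ->
  exists mu, q = mu *: p.
Proof.
move=> /cV2_neq0/orP[] pi pq.
  exists (q 0 0 / p 0 0); apply: cV2P; rewrite mxE ?divfK //.
  by apply: (mulfI pi); rewrite pq; field.
exists (q 1 0 / p 1 0); apply: cV2P; rewrite mxE ?divfK //.
by apply: (mulfI pi); rewrite -pq; field.
Qed.

(** The expansion is symmetric in [x] and [y]; this is how the two factors are swapped later. *)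
Lemma mul_sub_scalar_mx A (x y : K) :
  (A - x%:M) * (A - y%:M) = A *m A - (y + x) *: A + (x * y)%:M.
Proof.
rewrite -[LHS]/(_ *m _) mulmxBl !mulmxBr -scalar_mxM mul_mx_scalar mul_scalar_mx.
by rewrite scalerDl !opprD opprK !addrA.
Qed.

Lemma orbitS A (w : 'cV[K]_2) n : A ^+ n.+1 *m w = A *m (A ^+ n *m w).
Proof. by rewrite exprS mulmxA. Qed.

Lemma orbit_eigen A (w : 'cV[K]_2) mu n :
  A *m w = mu *: w -> A ^+ n *m w = mu ^+ n *: w.
Proof.
move=> Aw; elim: n => [|n IHn]; first by rewrite !expr0 mul1mx scale1r.
by rewrite orbitS IHn -scalemxAr Aw scalerA -exprSr.
Qed.

(** Intended for [B = A - mu]: Cayley-Hamilton then reads B A = nu B. *)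
Lemma mulmx_expr_eigen A (B : 'M[K]_2) (l : K) n :
  B *m A = l *: B -> B *m A ^+ n = l ^+ n *: B.
Proof.
move=> BA; elim: n => [|n IHn]; first by rewrite !expr0 mulmx1 scale1r.
by rewrite exprSr mulmxA IHn -scalemxAl BA scalerA -exprSr.
Qed.

Lemma mxtrace2 A : \tr A = A 0 0 + A 1 1.
Proof.
by rewrite /mxtrace !big_ord_recl big_ord0 addr0; congr (_ + A _ _); exact: val_inj.
Qed.

Lemma cayley_hamilton2 A mu nu : mu + nu = \tr A -> mu * nu = \det A ->
  (A - mu%:M) * (A - nu%:M) = 0.
Proof.
move=> trA detA; rewrite mul_sub_scalar_mx (addrC nu) trA detA mxtrace2 det22.
apply/matrixP => i j; rewrite [LHS]mxE [X in X + _]mxE mulmx2E !mxE.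
by case: (ord2P i) => ->; case: (ord2P j) => ->; rewrite /= ?mulr1n ?mulr0n; ring.
Qed.

(** Makes [\tr A - mu] the second eigenvalue. The two coordinates of A p = mu p, combined at a
    nonzero coordinate of [p], give (mu - a)(mu - d) = bc. *)
Lemma det_of_eigen A p mu : p != 0 -> A *m p = mu *: p ->
  mu * (\tr A - mu) = \det A.
Proof.
move=> p0 Ap; rewrite mxtrace2 det22.
have e0 : A 0 1 * p 1 0 = (mu - A 0 0) * p 0 0.
  by rewrite mulrBl; apply/esym/eqP; rewrite subr_eq addrC -mulmx2E Ap mxE.
have e1 : A 1 0 * p 0 0 = (mu - A 1 1) * p 1 0.
  by rewrite mulrBl; apply/esym/eqP; rewrite subr_eq -mulmx2E Ap mxE.
apply/eqP; rewrite -subr_eq0; apply/eqP.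
case/cV2_neq0/orP: p0 => pi; apply: (mulIf pi); rewrite mul0r.
  transitivity (A 0 1 * (A 1 0 * p 0 0) - (mu - A 1 1) * ((mu - A 0 0) * p 0 0)).
    by ring.
  by rewrite e1 -e0; ring.
transitivity (A 1 0 * (A 0 1 * p 1 0) - (mu - A 0 0) * ((mu - A 1 1) * p 1 0)).
  by ring.
by rewrite e0 -e1; ring.
Qed.

Lemma char_poly_split2 A lp lm : char_poly A = ('X - lp%:P) * ('X - lm%:P) ->
  lp + lm = \tr A /\ lp * lm = \det A.
Proof.
move=> chiA.
have := char_poly_trace A (ltn0Sn 1); have := char_poly_det A.
rewrite chiA expr2 mulrNN !mul1r => <-.
have -> : ('X - lp%:P) * ('X - lm%:P)
          = 'X^2 - (lp + lm) *: 'X + (lp * lm)%:P.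
  by rewrite -mul_polyC polyCD polyCM; move: lp%:P lm%:P => x y; ring.
rewrite /= !(coefD, coefN, coefZ, coefXn, coefX, coefC) /=.
rewrite !(mulr0, mulr1, addr0, add0r, subr0, sub0r, oppr0).
by move=> /oppr_inj.
Qed.

End Matrices2.

(** * Convergence of lines, and constraints on limits of orbits *)

Section ProjectiveConvergence.
Variable K : numFieldType.
Implicit Types (w : nat -> 'cV[K]_2) (p q : 'cV[K]_2) (A : 'M[K]_2).

(* For [p != 0] this is convergence of the lines spanned by the [w n]; it turns
   limits in P^1 into limits of scalars. *)
Definition proj_tends_to w p : Prop :=
  exists s : nat -> K, forall i, tends_to (fun n => s n * w n i 0) (p i 0).

(** Uniqueness of the limit line: both sides are limits of the same product s_n t_n w_n(0)
    w_n(1). *)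
Lemma proj_tends_to_collinear w p q :
  proj_tends_to w p -> proj_tends_to w q -> p 0 0 * q 1 0 = p 1 0 * q 0 0.
Proof.
move=> [s sp] [t tq].
have h1 := tends_toM (sp 0) (tq 1).
have h2 := tends_toM (sp 1) (tq 0).
apply: tends_to_unique h1 _. apply: eq_tends_to _ h2 => n /=; ring.
Qed.

Lemma tends_to_mulmx A (u : nat -> 'cV[K]_2) p i :
  (forall j, tends_to (fun n => u n j 0) (p j 0)) ->
  tends_to (fun n => (A *m u n) i 0) ((A *m p) i 0).
Proof.
move=> up; rewrite mulmx2E.
apply: (@eq_tends_to _ (fun n => A i 0 * u n 0 0 + A i 1 * u n 1 0)).
  by move=> n; rewrite mulmx2E.
by apply: tends_toD; apply: tends_toM; rewrite ?up //; exact: tends_to_cst.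
Qed.

Lemma proj_tends_to_mulmx A w p :
  proj_tends_to w p -> proj_tends_to (fun n => A *m w n) (A *m p).
Proof.
move=> [s sp]; exists s => i.
apply: eq_tends_to _ (tends_to_mulmx A i (u := fun n => s n *: w n) _) => [n|j].
  by rewrite -scalemxAr mxE.
by apply: eq_tends_to _ (sp j) => n; rewrite mxE.
Qed.

Lemma proj_tends_to_sub (f : nat -> nat) w p : (forall n, n <= f n)%N ->
  proj_tends_to w p -> proj_tends_to (w \o f) p.
Proof.
move=> fn [s sp]; exists (s \o f) => i.
exact: tends_to_sub fn (sp i).
Qed.

(** The shifted orbit tends to the line of [p] as a subsequence and to that of A p by continuity. *)
Lemma orbit_limit_eigen A (w p : 'cV[K]_2) : p != 0 ->
  proj_tends_to (fun n => A ^+ n *m w) p -> exists mu, A *m p = mu *: p.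
Proof.
move=> p0 wp; apply: collinear_eigen => //.
apply: (@proj_tends_to_collinear (fun n => A ^+ n.+1 *m w)).
  exact: (@proj_tends_to_sub S _ _ leqnSn wp).
have [s sp] := proj_tends_to_mulmx A wp.
by exists s => i; apply: eq_tends_to _ (sp i) => n; rewrite orbitS.
Qed.

(** The orbit stays on the line of [w]: both sides are limits of s_n mu^n w(0) w(1). *)
Lemma orbit_limit_of_eigen A (w p : 'cV[K]_2) mu :
  A *m w = mu *: w -> proj_tends_to (fun n => A ^+ n *m w) p ->
  p 0 0 * w 1 0 = p 1 0 * w 0 0.
Proof.
move=> Aw [s sp].
have h1 := tends_toM (sp 0) (tends_to_cst (w 1 0)).
have h2 := tends_toM (sp 1) (tends_to_cst (w 0 0)).
apply: tends_to_unique h1 _; apply: eq_tends_to _ h2 => n /=.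
rewrite (orbit_eigen n Aw) !mxE; ring.
Qed.

Lemma tends_to0_le (u v : nat -> K) :
  (forall n, `|v n| <= `|u n|) -> tends_to u 0 -> tends_to v 0.
Proof.
move=> vu /tends_toP u0; apply/tends_toP => e e0.
apply: filterS (u0 _ e0) => n.
by rewrite !sub0r !normrN; exact: le_lt_trans.
Qed.

(* If the orbit converges to the eigenline of the smaller eigenvalue [mu], its
   component along the other eigenline must vanish. *)
Lemma orbit_to_small_eigen A (w p : 'cV[K]_2) mu nu : p != 0 ->
  (A - mu%:M) * (A - nu%:M) = 0 -> A *m p = mu *: p ->
  mu != nu -> `|mu| <= `|nu| ->
  proj_tends_to (fun n => A ^+ n *m w) p -> (A - mu%:M) *m w = 0.
Proof.
move=> p0 CH Ap munu lemunu [s sp].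
have CH' : (A - nu%:M) * (A - mu%:M) = 0.
  by rewrite mul_sub_scalar_mx (addrC mu) (mulrC nu) -mul_sub_scalar_mx CH.
have CHE x y : (A - x%:M) * (A - y%:M) = 0 -> (A - x%:M) *m A = y *: (A - x%:M).
  by rewrite -[_ * _]/(_ *m _) mulmxBr mul_mx_scalar => /subr0_eq.
(* Applying A - mu or A - nu to the scaled orbit isolates one eigencomponent, which evolves by the
   scalar s_n nu^n or s_n mu^n respectively. *)
have comp (B : 'M[K]_2) x : B *m A = x *: B -> forall i,
    tends_to (fun n => s n * x ^+ n * (B *m w) i 0) ((B *m p) i 0).
  move=> BA i.
  apply: eq_tends_to _ (tends_to_mulmx B i (u := fun n => s n *: (A ^+ n *m w)) _).
    move=> n; rewrite -scalemxAr mulmxA (mulmx_expr_eigen _ BA).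
    by rewrite -scalemxAl !mxE mulrA.
  by move=> j; apply: eq_tends_to _ (sp j) => n; rewrite [in RHS]mxE.
have hmu := comp _ _ (CHE _ _ CH'); have hnu := comp _ _ (CHE _ _ CH).
have Bp : (A - mu%:M) *m p = 0 by rewrite mulmxBl Ap mul_scalar_mx subrr.
have B'p : (A - nu%:M) *m p = (mu - nu) *: p.
  by rewrite mulmxBl Ap mul_scalar_mx scalerBl.
(* If (A - mu) w is nonzero, then s_n nu^n tends to 0, because (A - mu) p = 0. So does s_n mu^n, its
   modulus being no larger; then (mu - nu) p = 0. *)
apply/eqP/negP => /negP Bw.
have snu0 : tends_to (fun n => s n * nu ^+ n) 0.
  have /cV0Pn[i wi] := Bw.
  have := tends_toM (hnu i) (tends_to_cst (((A - mu%:M) *m w) i 0)^-1).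
  rewrite Bp [X in X * _]mxE mul0r; apply: eq_tends_to => n; exact: mulfK.
have smu0 : tends_to (fun n => s n * mu ^+ n) 0.
  apply: tends_to0_le snu0 => n.
  rewrite !normrM !normrX ler_wpM2l // lerXn2r // nnegrE normr_ge0.
suff /eqP : p = 0 by rewrite (negPf p0).
have pi i : p i 0 = 0.
  apply: (mulfI (_ : mu - nu != 0)); first by rewrite subr_eq0.
  have := hmu i; rewrite B'p [X in tends_to _ X]mxE mulr0 => h.
  apply: tends_to_unique h _.
  rewrite -[X in tends_to _ X](mul0r (((A - nu%:M) *m w) i 0)).
  by apply: tends_toM => //; exact: tends_to_cst.
by apply: cV2P; rewrite mxE pi.
Qed.
End ProjectiveConvergence.

(** * Explicit limits of orbits *)

Section OrbitLimits.
Variable K : numFieldType.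
Implicit Types (A : 'M[K]_2) (w : 'cV[K]_2).

(** Subtracting (A - lp) A^n = lm^n (A - lp) from (A - lm) A^n = lp^n (A - lm) isolates A^n. After
    division by lp^n only the term in A - lm survives. *)
Lemma orbit_dominant A w lp lm : (A - lm%:M) * (A - lp%:M) = 0 ->
  lp != 0 -> lp != lm -> tends_to (fun n => (lm / lp) ^+ n) 0 ->
  proj_tends_to (fun n => A ^+ n *m w) ((A - lm%:M) *m w).
Proof.
move=> CH lp0 lpm geo.
have Em : (A - lm%:M) *m A = lp *: (A - lm%:M).
  by move: CH; rewrite -[_ * _]/(_ *m _) mulmxBr mul_mx_scalar => /subr0_eq.
have Ep : (A - lp%:M) *m A = lm *: (A - lp%:M).
  move: CH; rewrite mul_sub_scalar_mx (addrC lp) (mulrC lm) -mul_sub_scalar_mx.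
  by rewrite -[_ * _]/(_ *m _) mulmxBr mul_mx_scalar => /subr0_eq.
have AE n : (lp - lm) *: A ^+ n = lp ^+ n *: (A - lm%:M) - lm ^+ n *: (A - lp%:M).
  rewrite -(mulmx_expr_eigen n Em) -(mulmx_expr_eigen n Ep) -mulmxBl.
  have -> : A - lm%:M - (A - lp%:M) = (lp - lm)%:M.
    by rewrite opprB addrC addrA subrK raddfB.
  by rewrite mul_scalar_mx.
exists (fun n => (lp - lm) / lp ^+ n) => i.
have h : tends_to (fun n => ((A - lm%:M) *m w) i 0
    - (lm / lp) ^+ n * ((A - lp%:M) *m w) i 0) (((A - lm%:M) *m w) i 0).
  have := tends_toD (tends_to_cst (((A - lm%:M) *m w) i 0))
    (tends_toM geo (tends_to_cst (- ((A - lp%:M) *m w) i 0))).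
  by rewrite mul0r addr0; apply: eq_tends_to => n; rewrite mulrN.
apply: eq_tends_to _ h => n.
have lpn0 : lp ^+ n != 0 by rewrite expf_neq0.
apply/esym/(mulfI lpn0).
transitivity (((lp - lm) *: A ^+ n *m w) i 0).
  by rewrite -scalemxAl [RHS]mxE mulrA mulrCA divff // mulr1.
rewrite AE mulmxBl -!scalemxAl; move: (_ *m w) (_ *m w) => x y.
rewrite !mxE mulrBr; congr (_ - _).
by rewrite mulrA -exprMn [lp * _]mulrC divfK.
Qed.

(** Here N = A - l has square zero, so A^n = l^n + n l^(n-1) N, and the term in N dominates by a
    factor of order n. *)
Lemma orbit_parabolic A w l : (A - l%:M) * (A - l%:M) = 0 ->
  l != 0 -> tends_to (fun n => (n%:R : K)^-1) 0 ->
  proj_tends_to (fun n => A ^+ n *m w) ((A - l%:M) *m w).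
Proof.
move=> CH l0 harm.
have EN : (A - l%:M) *m A = l *: (A - l%:M).
  by move: CH; rewrite -[_ * _]/(_ *m _) mulmxBr mul_mx_scalar => /subr0_eq.
(* The extra factor [l] avoids the exponent n - 1. *)
have AE n : l *: A ^+ n = l ^+ n.+1 *: 1 + (n%:R * l ^+ n) *: (A - l%:M).
  elim: n => [|n IHn]; first by rewrite !expr0 mul0r scale0r addr0 expr1.
  have -> : l *: A ^+ n.+1 = (l *: A ^+ n) *m A.
    by rewrite -scalemxAl exprSr.
  rewrite IHn mulmxDl -!scalemxAl EN mul1mx.
  have -> : l ^+ n.+1 *: A = l ^+ n.+2 *: 1 + l ^+ n.+1 *: (A - l%:M).
    by rewrite scalerBr addrC -scalemx1 scalerA -exprSr subrK.
  rewrite scalerA -addrA -scalerDl; congr (_ + _ *: _).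
  by rewrite -natr1 !exprS; ring.
exists (fun n => l / (n%:R * l ^+ n)) => i.
have h : tends_to (fun n => n%:R^-1 * (l * w i 0) + ((A - l%:M) *m w) i 0)
    (((A - l%:M) *m w) i 0).
  have := tends_toD (tends_toM harm (tends_to_cst (l * w i 0)))
    (tends_to_cst (((A - l%:M) *m w) i 0)).
  by rewrite mul0r add0r.
(* At n = 0 the scale is 0 by the convention on division, so the comparison starts at 1. *)
apply: near_tends_to h; exists 1%N => // n /= n1.
have n0 : (n%:R : K) != 0 by rewrite pnatr_eq0 -lt0n.
have ln0 : l ^+ n != 0 by rewrite expf_neq0.
apply: esym.
have -> : l / (n%:R * l ^+ n) * (A ^+ n *m w) i 0
    = (n%:R * l ^+ n)^-1 * ((l *: A ^+ n) *m w) i 0.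
  by rewrite -scalemxAl [in RHS]mxE mulrCA mulrA.
rewrite AE mulmxDl -!scalemxAl mul1mx; move: (_ *m w) => x.
rewrite !mxE exprS.
by field; rewrite n0 ln0.
Qed.

Lemma orbit_eigen_tends_to A w l : l != 0 -> A *m w = l *: w ->
  proj_tends_to (fun n => A ^+ n *m w) w.
Proof.
move=> l0 Aw; exists (fun n => l ^- n) => i.
apply: eq_tends_to _ (tends_to_cst (w i 0)) => n.
by rewrite (orbit_eigen n Aw) mxE mulKf // expf_neq0.
Qed.

End OrbitLimits.

(** * Translation between limits in P^1 and limits of lines *)

Section ProjectiveLine.
Variable R : realType.
Local Notation C := R[i].

Lemma complex_geometric (z : C) : `|z| < 1 -> tends_to (fun n => z ^+ n) 0.
Proof.
move=> z1; apply/tends_toP => e /gt0_complex[r r0 ->].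
have : `|normr_val z| < 1.
  by rewrite ger0_norm ?normr_val_ge0 // -ltcR normr_valE rmorph1.
move=> /cvg_expr/cvgrPdist_lt/(_ _ r0); apply: filterS => n.
rewrite !sub0r !normrN !normrX -(normr_valE z) => h.
by rewrite -rmorphXn ltcR -[X in X ^+ _]ger0_norm ?normr_val_ge0.
Qed.

Lemma complex_harmonic : tends_to (fun n => (n%:R : C)^-1) 0.
Proof.
apply/tends_toP => e /gt0_complex[r r0 ->].
exists (Num.truncn r^-1).+1 => // n /= rn.
have n0 : 0 < n%:R :> R by rewrite ltr0n (leq_trans _ rn).
rewrite sub0r normrN normfV normr_nat -(rmorph_nat (real_complex R)) -fmorphV ltcR.
rewrite invf_plt ?posrE //.
by rewrite (lt_le_trans (truncnS_gt _)) // ler_nat.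
Qed.

Lemma P1_ratio_eq (p q : 'cV[C]_2) : p != 0 -> q != 0 ->
  (P1_ratio (p 0 0) (p 1 0) = P1_ratio (q 0 0) (q 1 0) <->
   p 0 0 * q 1 0 = p 1 0 * q 0 0).
Proof.
move=> /cV2_neq0 p0 /cV2_neq0 q0; rewrite /P1_ratio.
case: (p 1 0 =P 0) p0 => [->|/eqP p1] p0; case: (q 1 0 =P 0) q0 => [->|/eqP q1] q0.
- by split=> // _; rewrite mulr0 mul0r.
- split=> // /eqP; rewrite mul0r mulf_eq0 (negPf q1) orbF.
  by move: p0; rewrite orbF => /negPf ->.
- split=> // /esym/eqP; rewrite mulr0 mulf_eq0 (negPf p1) /=.
  by move: q0; rewrite orbF => /negPf ->.
split=> [[] h|h]; first by rewrite -[p 0 0](divfK p1) h mulrAC divfK // mulrC.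
by congr Some; apply/eqP; rewrite eqr_div // h mulrC.
Qed.

Lemma P1_ratio_surj (v : P1 R) :
  exists2 p : 'cV[C]_2, p != 0 & v = P1_ratio (p 0 0) (p 1 0).
Proof.
case: v => [z|].
  exists (\col_i if i == 0 then z else 1); last first.
    by rewrite !mxE /P1_ratio /= oner_eq0 divr1.
  by apply/cV0Pn; exists 1; rewrite mxE oner_eq0.
exists (\col_i if i == 0 then 1 else 0); last by rewrite !mxE /P1_ratio /= eqxx.
by apply/cV0Pn; exists 0; rewrite mxE oner_eq0.
Qed.

(** The unknown scale cancels in the quotient of the coordinates. At oo it is the inverse quotient
    that tends to 0. *)
Lemma P1_cvg_of_proj (w : nat -> 'cV[C]_2) (p : 'cV[C]_2) : p != 0 ->
  proj_tends_to w p ->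
  P1_ratio (w n 0 0) (w n 1 0) @[n --> \oo] --> (P1_ratio (p 0 0) (p 1 0) : P1 R).
Proof.
move=> /cV2_neq0 p0 [s sp]; rewrite {2}/P1_ratio.
case: (p 1 0 =P 0) p0 => [p1|/eqP p1 _ U].
  rewrite orbF => p0 U /near_None[UN [r rU]].
  have h : tends_to (fun n => (s n * w n 1 0) / (s n * w n 0 0)) 0.
    have := tends_toM (sp 1) (tends_toV p0 (sp 0)).
    by rewrite p1 mul0r.
  (* An inverse quotient below 1 / (|r| + 1) means a quotient above r; the added 1 keeps the bound
     positive. *)
  have e0 : 0 < (`|r| + 1)^-1%:C%C by rewrite ltcR invr_gt0 ltr_wpDl.
  have /tends_toP/(_ _ e0) h' := h.
  apply: filterS2 (tends_to_neq0 p0 (sp 0)) h' => n sw0 lt.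
  rewrite /= /P1_ratio; case: (w n 1 0 =P 0) => // /eqP w1; apply: rU.
  have [s0 w0] : s n != 0 /\ w n 0 0 != 0.
    by apply/andP; rewrite -negb_or -mulf_eq0.
  move: lt; rewrite sub0r normrN -mulf_div divff // mul1r -[w n 1 0 / _]invf_div.
  have r1 : 0 < `|r| + 1 by rewrite ltr_wpDl.
  have z0 : 0 < `|w n 0 0 / w n 1 0| by rewrite normr_gt0 mulf_neq0 ?invr_neq0.
  rewrite normfV fmorphV ltf_pV2 ?posrE //; last by rewrite ltcR.
  by apply: lt_trans; rewrite ltcR (le_lt_trans (ler_norm _)) // ltrDl.
move=> /near_Some[e e0 eU].
have /tends_toP/(_ _ e0) h := tends_toM (sp 0) (tends_toV p1 (sp 1)).
apply: filterS2 (tends_to_neq0 p1 (sp 1)) h => n sw1 lt.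
have [s0 w1] : s n != 0 /\ w n 1 0 != 0.
  by apply/andP; rewrite -negb_or -mulf_eq0.
rewrite /= /P1_ratio (negPf w1); apply: eU.
by move: lt; rewrite -mulf_div divff // mul1r.
Qed.

(** The scale is chosen to make one coordinate, at which [p] does not vanish, eventually constant;
    convergence in P^1 controls the other. *)
Lemma proj_of_P1_cvg (w : nat -> 'cV[C]_2) (p : 'cV[C]_2) : p != 0 ->
  (forall n, w n != 0) ->
  P1_ratio (w n 0 0) (w n 1 0) @[n --> \oo] --> (P1_ratio (p 0 0) (p 1 0) : P1 R) ->
  proj_tends_to w p.
Proof.
move=> /cV2_neq0 p0 wn0; rewrite {2}/P1_ratio.
case: (p 1 0 =P 0) p0 => [p1|/eqP p1 _ cv].
  rewrite orbF => p0 cv.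
  have w0 : \forall n \near \oo, w n 0 0 != 0.
    (* As [w n] is nonzero, its first coordinate vanishes only at the point 0 of P^1, which is far
       from oo. *)
    have : nbhs (None : P1 R) [set v | v <> Some 0].
      apply: (near_None _).2; split=> //; exists 0 => z /[swap] -[->].
      by rewrite normr0 ltxx.
    move=> /cv; rewrite nbhs_simpl /= => h.
    apply: filterS h => n /=; rewrite /P1_ratio.
    have := cV2_neq0 (wn0 n); case: (w n 1 0 =P 0) => [_|_ _]; first by rewrite orbF.
    by move=> ne; apply/eqP => w0; apply: ne; rewrite w0 mul0r.
  exists (fun n => p 0 0 / w n 0 0).
  have t0 : tends_to (fun n => p 0 0 / w n 0 0 * w n 0 0) (p 0 0).
    apply: near_tends_to (tends_to_cst (p 0 0)).
    by apply: filterS w0 => n wn; rewrite divfK.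
  have t1 : tends_to (fun n => p 0 0 / w n 0 0 * w n 1 0) (p 1 0).
    rewrite p1; apply/tends_toP => e e0.
    have [r r0 rE] : exists2 r, 0 < r & `|p 0 0| / e = r%:C%C.
      by apply: gt0_complex; rewrite divr_gt0 ?normr_gt0.
    have : nbhs (None : P1 R) [set v | forall z, v = Some z -> r%:C%C < `|z|].
      by apply: (near_None _).2; split=> //; exists r => z rz _ [<-].
    move=> /cv; rewrite nbhs_simpl /= => h; apply: filterS2 w0 h => n wn0' /=.
    rewrite /P1_ratio sub0r normrN.
    case: (w n 1 0 =P 0) => [-> _|/eqP w1 /(_ _ erefl)].
      by rewrite mulr0 normr0.
    rewrite -rE !normf_div normrM normf_div ltr_pdivrMr // mulrC.
    rewrite mulrA ltr_pdivlMr ?normr_gt0 // => lt.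
    by rewrite mulrAC ltr_pdivrMr ?normr_gt0.
  by move=> i; case: (ord2P i) => ->.
have w1 : \forall n \near \oo, w n 1 0 != 0.
  have : nbhs (Some (p 0 0 / p 1 0) : P1 R) [set v | v <> None].
    by apply: (near_Some _ _).2; exists 1.
  move=> /cv; rewrite nbhs_simpl /= => h.
  apply: filterS h => n /=; rewrite /P1_ratio.
  by case: (w n 1 0 =P 0).
exists (fun n => p 1 0 / w n 1 0).
have t1 : tends_to (fun n => p 1 0 / w n 1 0 * w n 1 0) (p 1 0).
  apply: near_tends_to (tends_to_cst (p 1 0)).
  by apply: filterS w1 => n wn; rewrite divfK.
have t0 : tends_to (fun n => p 1 0 / w n 1 0 * w n 0 0) (p 0 0).
  have h : tends_to (fun n => w n 0 0 / w n 1 0) (p 0 0 / p 1 0).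
    apply/tends_toP => e e0.
    have : nbhs (Some (p 0 0 / p 1 0) : P1 R)
        [set v | forall z, v = Some z -> `|p 0 0 / p 1 0 - z| < e].
      by apply: (near_Some _ _).2; exists e => // z lt _ [<-].
    move=> /cv; rewrite nbhs_simpl /= => h; apply: filterS2 w1 h => n /negPf w1' /=.
    by rewrite /P1_ratio w1'; exact.
  have := tends_toM (tends_to_cst (p 1 0)) h; rewrite mulrC divfK //.
  by apply: eq_tends_to => n; rewrite mulrA mulrAC.
by move=> i; case: (ord2P i) => ->.
Qed.

(** The rows of A u = l u say that [u] is collinear with (l - d, c) and with (b, l - a). Both vanish
    only if A = l. *)
Lemma P1_ratio_eigen (A : 'M[C]_2) (l : C) (u : 'cV[C]_2) : u != 0 ->
  A *m u = l *: u -> A <> l%:M -> P1_ratio (u 0 0) (u 1 0) = beta A l.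
Proof.
move=> u0 Au Al.
have e0 : A 0 0 * u 0 0 + A 0 1 * u 1 0 = l * u 0 0.
  by rewrite -mulmx2E Au mxE.
have e1 : A 1 0 * u 0 0 + A 1 1 * u 1 0 = l * u 1 0.
  by rewrite -mulmx2E Au mxE.
have eqr x y : (x != 0) || (y != 0) -> u 0 0 * y = u 1 0 * x ->
    P1_ratio (u 0 0) (u 1 0) = P1_ratio x y.
  move=> xy uxy; pose q : 'cV[C]_2 := \col_i if i == 0 then x else y.
  have [qx qy] : q 0 0 = x /\ q 1 0 = y by rewrite !mxE.
  rewrite -qx -qy; apply/P1_ratio_eq => //; last by rewrite qx qy.
  by apply/cV0Pn; case/orP: xy => ?; [exists 0|exists 1]; rewrite mxE.
rewrite /beta; case: ifPn => [/andP[/eqP ld /eqP c0]|nz]; last first.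
  apply: eqr; first by rewrite -negb_and.
  by rewrite mulrBr [_ * A 1 1]mulrC (mulrC _ l) -e1; ring.
apply: eqr; last first.
  by rewrite mulrBr [_ * l]mulrC -e0; ring.
rewrite -negb_and; apply/negP => /andP[/eqP b0 /eqP la]; apply: Al.
apply/matrixP => i j; case: (ord2P i) => ->; case: (ord2P j) => ->; rewrite !mxE //=.
  by rewrite mulr1n; move/subr0_eq: la.
by rewrite mulr1n; move/subr0_eq: ld.
Qed.

End ProjectiveLine.

(** * Condition (3) in terms of eigenvalues *)

Section EigenvalueModuli.
Variable K : numClosedFieldType.
Implicit Types (mu nu e : K).

(** On the unit circle conjugation is inversion, whence e (mu + nu)^2 = |mu + nu|^2 and 4 - e (mu +
    nu)^2 = |mu - nu|^2. *)
Lemma unimodular_trace_bound mu nu e : e ^+ 2 = 1 -> mu * nu = e ->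
  `|mu| = 1 -> `|nu| = 1 -> mu != nu ->
  (mu + nu) ^+ 2 \is Num.real /\ 0 <= e * (mu + nu) ^+ 2 < 4.
Proof.
move=> e2 munu mu1 nu1 ne.
have conjE (x : K) : `|x| = 1 -> x^* = x^-1.
  move=> x1; have x0 : x != 0 by rewrite -normr_eq0 x1 oner_eq0.
  by apply: (mulfI x0); rewrite divff // -normCK x1 expr1n.
have mu0 : mu != 0 by rewrite -normr_eq0 mu1 oner_eq0.
have nu0 : nu != 0 by rewrite -normr_eq0 nu1 oner_eq0.
have eV : e = mu^-1 * nu^-1.
  have e0 : e != 0 by rewrite -munu mulf_neq0.
  by rewrite -invfM munu; apply: (mulfI e0); rewrite divff // -expr2.
have h1 : e * (mu + nu) ^+ 2 = `|mu + nu| ^+ 2.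
  by rewrite normCK rmorphD /= !conjE // eV; field; rewrite mu0 nu0.
have h2 : 4 - e * (mu + nu) ^+ 2 = `|mu - nu| ^+ 2.
  by rewrite normCK rmorphB /= !conjE // eV; field; rewrite mu0 nu0.
split.
  rewrite -[_ ^+ 2]mul1r -e2 expr2 -mulrA h1 rpredM ?rpredX ?normr_real //.
  have : e ^+ 2 == 1 ^+ 2 by rewrite e2 expr1n.
  by rewrite eqf_sqr => /orP[]/eqP ->; rewrite ?rpredN rpred1.
by rewrite -subr_gt0 h2 h1 exprn_ge0 //= exprn_gt0 // normr_gt0 subr_eq0.
Qed.

(** Conjugation fixes q^2, so it sends q to q or -q; in the first case q is real, hence 0. *)
Lemma conj_of_sqr_le0 (q : K) : q ^+ 2 <= 0 -> q^* = - q.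
Proof.
move=> q0; have : (q^*) ^+ 2 == q ^+ 2.
  by rewrite -rmorphXn /=; apply/eqP/conj_Creal; exact: ler0_real.
rewrite eqf_sqr => /orP[]/eqP // qr.
have : 0 <= q ^+ 2 by rewrite real_exprn_even_ge0 //; exact/CrealP.
move=> q0'; have : q ^+ 2 == 0 by rewrite eq_le q0 q0'.
by rewrite sqrf_eq0 => /eqP ->; rewrite conjC0 oppr0.
Qed.

(* The quotient [(mu + nu) / (mu - nu)] is purely imaginary. *)
Lemma elliptic_moduli mu nu e : e ^+ 2 = 1 -> mu * nu = e ->
  0 <= e * (mu + nu) ^+ 2 < 4 -> mu != nu /\ `|mu| = `|nu|.
Proof.
move=> e2 munu /andP[x0 x4].
have zE : e * (mu - nu) ^+ 2 = e * (mu + nu) ^+ 2 - 4.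
  have -> : 4 = 4 * e ^+ 2 :> K by rewrite e2 mulr1.
  by rewrite -munu; ring.
have ne : mu - nu != 0.
  apply/eqP => d0; move: zE; rewrite d0 expr0n mulr0 => /esym/subr0_eq x.
  by move: x4; rewrite x ltxx.
split; first by rewrite -subr_eq0.
pose q := (mu + nu) / (mu - nu).
have e0 : e != 0 by rewrite -sqrf_eq0 e2 oner_eq0.
have /conj_of_sqr_le0 qJ : q ^+ 2 <= 0.
  have -> : q ^+ 2 = (e * (mu + nu) ^+ 2) / (e * (mu - nu) ^+ 2).
    by rewrite /q; field; rewrite ne e0.
  by rewrite mulr_ge0_le0 // invr_le0 zE subr_le0 ltW.
(* Conjugation sends q + 1 to -(q - 1), so both factors have the same modulus. *)
have muE : mu = (mu - nu) / 2 * (q + 1).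
  by rewrite /q; field.
have nuE : nu = (mu - nu) / 2 * (q - 1).
  by rewrite /q; field.
rewrite muE [RHS](congr1 Num.norm nuE) !(normrM (_ / 2)); congr (_ * _).
by rewrite -[LHS]norm_conjC rmorphD /= rmorph1 qJ -normrN opprD opprK.
Qed.

End EigenvalueModuli.

(** * Convergents as orbits of E(P) *)

Section ContinuedFractionMatrices.
Variable R : realType.
Local Notation C := R[i].
Implicit Types (a b s t : seq C).

Lemma Mmx_cat s t : Mmx (s ++ t) = Mmx s *m Mmx t.
Proof. by rewrite /Mmx big_cat. Qed.

Lemma mul_col m n p (A : 'M[C]_(m, n)) (B : 'M[C]_(n, p)) j :
  A *m col j B = col j (A *m B).
Proof. by rewrite !colE mulmxA. Qed.

Lemma mkseqD (T : Type) (f : nat -> T) m n :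
  mkseq f (m + n) = mkseq f m ++ mkseq (fun i => f (m + i)%N) n.
Proof.
by rewrite /mkseq iotaD map_cat add0n -[m in iota m n]addn0 iotaDl -map_comp.
Qed.

Definition convergent_mx b a n : 'M[C]_2 := Mmx (mkseq (partial_quotient b a) n).

Definition period_mx a n : 'M[C]_2 := Mmx (mkseq (periodic_ext a) n).

Definition convergent_vec b a n : 'cV[C]_2 := col 0 (convergent_mx b a n).

Lemma convergentE b a n :
  convergent b a n = P1_ratio (convergent_vec b a n 0 0) (convergent_vec b a n 1 0).
Proof. by rewrite !mxE. Qed.

Lemma convergent_mx_tail b a n :
  convergent_mx b a (size b + n) = Mmx b *m period_mx a n.
Proof.
rewrite /convergent_mx mkseqD Mmx_cat; congr (Mmx _ *m Mmx _).
  rewrite -[RHS](mkseq_nth 0); apply/eq_in_map => i; rewrite mem_iota /= => ib.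
  by rewrite /partial_quotient ib.
apply/eq_map => i.
by rewrite /partial_quotient ltnNge leq_addr /= addKn.
Qed.

Lemma period_mx_shift a n : period_mx a (size a + n) = Mmx a *m period_mx a n.
Proof.
rewrite /period_mx mkseqD Mmx_cat; congr (Mmx _ *m Mmx _).
  rewrite -[RHS](mkseq_nth 0); apply/eq_in_map => i; rewrite mem_iota /= => ia.
  by rewrite /periodic_ext modn_small.
by apply/eq_map => i; rewrite /periodic_ext modnDl.
Qed.

Lemma period_mx_from a j :
  period_mx a (j + size a) = period_mx a j *m Mmx (period_from a j).
Proof. by rewrite /period_mx mkseqD Mmx_cat. Qed.

(** Since E M(b) = M(b) M(a), multiplying by E inserts one more period right after [b]. *)
Lemma Emx_convergent_mx b a j :
  Emx b a *m convergent_mx b a (size b + j)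
  = convergent_mx b a (size b + (size a + j)).
Proof.
rewrite !convergent_mx_tail period_mx_shift /Emx -[_ * _ * _]/(_ *m _ *m _).
by rewrite -!mulmxA (mulmxA _ (Mmx b)) mulVmx ?mul1mx //; exact: Mmx_unit.
Qed.

(** The new period can equally be appended at the end. This makes E conjugate to the matrix of each
    rotated period, which links condition (2) to E. *)
Lemma Emx_period b a j :
  Emx b a *m convergent_mx b a (size b + j)
  = convergent_mx b a (size b + j) *m Mmx (period_from a j).
Proof.
rewrite Emx_convergent_mx !convergent_mx_tail addnC.
by rewrite addnC [(size a + j)%N]addnC period_mx_from mulmxA.
Qed.

Lemma convergent_mx_unit b a n : convergent_mx b a n \in unitmx.
Proof. exact: Mmx_unit. Qed.

Lemma convergent_vec_neq0 b a n : convergent_vec b a n != 0.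
Proof.
apply/eqP => v0.
have : convergent_mx b a n *m delta_mx 0 (0 : 'I_1) = 0 by rewrite -colE.
move=> /(congr1 (mulmx (invmx (convergent_mx b a n)))).
rewrite mulKmx ?convergent_mx_unit // mulmx0 => /matrixP/(_ 0 0)/eqP.
by rewrite !mxE oner_eq0.
Qed.

Lemma Emx_expr_convergent_vec b a j n :
  Emx b a ^+ n *m convergent_vec b a (size b + j)
  = convergent_vec b a (size b + (j + n * size a)).
Proof.
elim: n => [|n IHn]; first by rewrite expr0 mul1mx mul0n addn0.
rewrite orbitS IHn /convergent_vec !mul_col Emx_convergent_mx.
by rewrite mulSn (addnCA j).
Qed.

(** The second column of D(c) is the first basis vector. *)
Lemma convergent_vecS b a n : convergent_vec b a n = col 1 (convergent_mx b a n.+1).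
Proof.
rewrite /convergent_vec /convergent_mx -[n.+1]addn1 mkseqD Mmx_cat.
apply/colP => i; rewrite [LHS]mxE [RHS]mxE mulmx2E /Mmx big_seq1 !mxE /=.
by rewrite mulr1 mulr0 addr0.
Qed.

(** Two consecutive convergent vectors are the columns of an invertible matrix, hence a basis. *)
Lemma convergent_vec_separate b a n (B : 'M[C]_2) :
  B *m convergent_vec b a n = 0 -> B *m convergent_vec b a n.+1 = 0 -> B = 0.
Proof.
rewrite {1}convergent_vecS /convergent_vec !mul_col => h1 h0.
rewrite -[B](mulmxK (convergent_mx_unit b a n.+1)).
suff -> : B *m convergent_mx b a n.+1 = 0 by rewrite mul0mx.
apply/matrixP => i j; case: (ord2P j) => ->.
  by have /colP/(_ i) := h0; rewrite !mxE.
by have /colP/(_ i) := h1; rewrite !mxE.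
Qed.

Lemma period_trace b a j : \tr (Mmx (period_from a j)) = \tr (Emx b a).
Proof.
have u := convergent_mx_unit b a (size b + j).
by rewrite -[Mmx _](mulKmx u) -Emx_period mxtrace_mulC mulmxK.
Qed.

Lemma period_det b a j : \det (Mmx (period_from a j)) = \det (Emx b a).
Proof. by rewrite det_Mmx det_Emx size_mkseq. Qed.

(** As E V = V A and the vector is V e_1, the eigenvector equation becomes A e_1 = mu e_1, a
    condition on the first column of A. *)
Lemma period_eigen b a j mu :
  Emx b a *m convergent_vec b a (size b + j) = mu *: convergent_vec b a (size b + j)
  <-> Mmx (period_from a j) 1 0 = 0 /\ Mmx (period_from a j) 0 0 = mu.
Proof.
set V := convergent_mx b a (size b + j); set A := Mmx _.
have EV : Emx b a *m convergent_vec b a (size b + j) = V *m col 0 A.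
  by rewrite /convergent_vec !mul_col Emx_period.
have -> : mu *: convergent_vec b a (size b + j) = V *m (mu *: delta_mx 0 0).
  by rewrite -scalemxAr -colE.
rewrite EV; split=> [/(congr1 (mulmx (invmx V)))|[A1 A0]].
  rewrite !mulKmx ?convergent_mx_unit // => /colP h.
  by move: (h 1) (h 0); rewrite !mxE /= mulr0 mulr1.
by congr (_ *m _); apply: cV2P; rewrite !mxE ?A1 ?A0 /= ?mulr0 ?mulr1.
Qed.

End ContinuedFractionMatrices.

(** * Necessity and sufficiency of the three conditions *)

Section Values.
Variable R : realType.
Local Notation C := R[i].
Variables a b : seq C.
Hypothesis a_gt0 : (0 < size a)%N.
Implicit Types p u : 'cV[C]_2.

(** The offset [j] may exceed the period: the consecutive offsets 0 and 1 are both used even when k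
    = 1. *)
Lemma has_value_orbit p j : p != 0 -> has_value b a (P1_ratio (p 0 0) (p 1 0)) ->
  proj_tends_to (fun n => Emx b a ^+ n *m convergent_vec b a (size b + j)) p.
Proof.
move=> p0; rewrite /has_value (funext (convergentE b a)).
move=> /(proj_of_P1_cvg p0 (convergent_vec_neq0 b a)).
have le n : (n <= size b + (j + n * size a))%N.
  by rewrite addnA (leq_trans (leq_pmulr n a_gt0)) // leq_addl.
move=> /(proj_tends_to_sub le)[s sp]; exists s => i.
by apply: eq_tends_to _ (sp i) => n /=; rewrite Emx_expr_convergent_vec.
Qed.

Lemma has_value_of_orbits (v : P1 R) :
  (forall j, (j < size a)%N -> exists u, [/\ u != 0, P1_ratio (u 0 0) (u 1 0) = v &
     proj_tends_to (fun n => Emx b a ^+ n *m convergent_vec b a (size b + j)) u]) ->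
  has_value b a v.
Proof.
move=> orb U Uv.
have [N _ UN] : \forall n \near \oo, U (convergent b a (size b + n)).
  apply: near_residues a_gt0 _ => j /orb[u [u0 uv cu]].
  have := P1_cvg_of_proj u0 cu; rewrite uv => /(_ U Uv).
  rewrite nbhs_simpl /=; apply: filterS => n.
  by rewrite /= convergentE Emx_expr_convergent_vec.
exists (size b + N)%N => // n /= le.
have bn : (size b <= n)%N := leq_trans (leq_addr _ _) le.
by rewrite -(subnKC bn); apply: UN => /=; rewrite leq_subRL.
Qed.

(** Otherwise E - mu kills two consecutive convergent vectors, so E = mu and the two eigenvalues
    coincide. *)
Lemma limit_eigenvalue_dominant p mu : p != 0 ->
  has_value b a (P1_ratio (p 0 0) (p 1 0)) -> Emx b a *m p = mu *: p ->
  mu != \tr (Emx b a) - mu -> `|\tr (Emx b a) - mu| < `|mu|.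
Proof.
move=> p0 cv Ep; set nu := _ - mu => munu.
have CH := cayley_hamilton2 (subrKC mu _) (det_of_eigen p0 Ep).
rewrite real_ltNge ?normr_real //; apply/negP => le.
have h j := orbit_to_small_eigen p0 CH Ep munu le (has_value_orbit j p0 cv).
have /subr0_eq Emu : Emx b a - mu%:M = 0.
  apply: (@convergent_vec_separate _ b a (size b)); first by rewrite -[size b]addn0.
  by rewrite -[(size b).+1]addn1.
by case/eqP: munu; rewrite /nu Emu mxtrace_scalar mulr2n addrK.
Qed.

Lemma has_value_not_scalar (v : P1 R) c : has_value b a v -> Emx b a <> c%:M.
Proof.
have [p p0 ->] := P1_ratio_surj v => cv Ec.
have Ew u : Emx b a *m u = c *: u by rewrite Ec mul_scalar_mx.
have h j := orbit_limit_of_eigen (Ew _) (has_value_orbit j p0 cv).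
(* The kernel of [B] is the line of [p], on which all these convergent vectors lie. *)
pose B : 'M[C]_2 :=
  \matrix_(i, j) if i == 0 then (if j == 0 then p 1 0 else - p 0 0) else 0.
have Bv j : B *m convergent_vec b a (size b + j) = 0.
  apply: cV2P; rewrite mulmx2E [B _ _]mxE [B _ 1]mxE [RHS]mxE /= ?mul0r ?addr0 //.
  by rewrite mulNr h subrr.
have B0 : B = 0.
  apply: (@convergent_vec_separate _ b a (size b)); first by rewrite -[size b]addn0.
  by rewrite -[(size b).+1]addn1.
have /matrixP B0' := B0; move: (B0' 0 0) (B0' 0 1); rewrite !mxE /= => p1 /eqP.
rewrite oppr_eq0 => /eqP p0'.
by move/negP: p0; apply; apply/eqP/cV2P; rewrite mxE.
Qed.

(** The rotated period is triangular with diagonal mu, nu and |mu| < 1 < |nu|. Its convergent vector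
    lies on the mu-line, so the value does too, against dominance. *)
Lemma has_value_period_mx (v : P1 R) j : has_value b a v ->
  Mmx (period_from a j) 1 0 = 0 -> ~ 1 < `|Mmx (period_from a j) 1 1|.
Proof.
have [p p0 ->] := P1_ratio_surj v => cv A10 A11.
set mu := Mmx (period_from a j) 0 0; set nu := Mmx (period_from a j) 1 1 in A11.
have trE : \tr (Emx b a) - mu = nu.
  by rewrite -(period_trace b a j) mxtrace2 addrC addKr.
have munu1 : `|mu| * `|nu| = 1.
  have := period_det b a j; rewrite det22 A10 mulr0 subr0 det_Emx -/mu -/nu.
  rewrite -normrM => ->.
  by rewrite normrX normrN1 expr1n.
have Ew : Emx b a *m convergent_vec b a (size b + j)
          = mu *: convergent_vec b a (size b + j) by apply/period_eigen.
have col := orbit_limit_of_eigen Ew (has_value_orbit j p0 cv).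
have Ep : Emx b a *m p = mu *: p.
  have [|c ->] := @collinear_eigen _ _ p (convergent_vec_neq0 b a (size b + j)).
    by rewrite mulrC -col mulrC.
  by rewrite -scalemxAr Ew !scalerA mulrC.
have lt : `|mu| < `|nu|.
  by rewrite (le_lt_trans _ A11) // -munu1 ler_peMr // ltW.
have := limit_eigenvalue_dominant p0 cv Ep; rewrite trE => h.
have ne : mu != nu by apply: contraTneq lt => ->; rewrite ltxx.
by move: (lt_trans lt (h ne)); rewrite ltxx.
Qed.

Lemma has_value_not_elliptic (v : P1 R) : has_value b a v ->
  ~ 0 <= (-1) ^+ size a * \tr (Emx b a) ^+ 2 < 4.
Proof.
have [p p0 ->] := P1_ratio_surj v => cv ell.
have [mu Ep] := orbit_limit_eigen p0 (has_value_orbit 0 p0 cv).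
have := limit_eigenvalue_dominant p0 cv Ep.
have := det_of_eigen p0 Ep; rewrite det_Emx; set nu := _ - mu => munu.
have trE : \tr (Emx b a) = mu + nu by rewrite addrC subrK.
rewrite trE in ell.
have [|ne ->] := elliptic_moduli _ munu ell.
  by rewrite -exprM mulnC exprM sqrrN !expr1n.
by move=> /(_ ne); rewrite ltxx.
Qed.

Lemma norm_labelling lp lm : eigenvalue_labelling (Emx b a) lp lm ->
  `|lp| * `|lm| = 1.
Proof.
move=> [/char_poly_split2[_ lpm] _ _].
by rewrite -normrM lpm det_Emx normrX normrN1 expr1n.
Qed.

(** Determinants give c^2 = (-1)^k = (i^k)^2, so condition (1) just says that E is scalar. *)
Lemma scalar_Emx c : Emx b a = c%:M ->
  Emx b a = ('i%C ^+ size a)%:M \/ Emx b a = (- 'i%C ^+ size a)%:M.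
Proof.
move=> Ec; have := det_Emx b a; rewrite Ec det_scalar -sqr_i -exprM mulnC exprM.
by move=> /eqP; rewrite eqf_sqr => /orP[]/eqP ->; [left|right].
Qed.

Lemma has_value_beta lp lm : eigenvalue_labelling (Emx b a) lp lm ->
  ~ (exists c, Emx b a = c%:M) ->
  ~ (exists j : nat, [/\ (j < size a)%N, Mmx (period_from a j) 1 0 = 0 &
       1 < `|Mmx (period_from a j) 1 1|]) ->
  ~ (\tr (Emx b a) ^+ 2 \is Num.real /\
     0 <= (-1) ^+ size a * \tr (Emx b a) ^+ 2 < 4) ->
  has_value b a (beta (Emx b a) lp).
Proof.
move=> lab nscal nper nell; have lpm1 := norm_labelling lab.
case: lab => /char_poly_split2[trE detE] lp1 lm1.
have lp0 : lp != 0 by rewrite -normr_gt0 (lt_le_trans ltr01).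
have lm0 : lm != 0.
  by apply: contra_eq_neq lpm1 => ->; rewrite normr0 mulr0 eq_sym oner_eq0.
have betaE u : u != 0 -> Emx b a *m u = lp *: u ->
    P1_ratio (u 0 0) (u 1 0) = beta (Emx b a) lp.
  by move=> u0 Eu; apply: P1_ratio_eigen => // Elp; apply: nscal; exists lp.
have CH : (Emx b a - lm%:M) * (Emx b a - lp%:M) = 0.
  by apply: cayley_hamilton2; rewrite 1?addrC 1?mulrC.
have CH' : (Emx b a - lp%:M) * (Emx b a - lm%:M) = 0 by exact: cayley_hamilton2.
have Eu w : Emx b a *m ((Emx b a - lm%:M) *m w) = lp *: ((Emx b a - lm%:M) *m w).
  apply/eqP; rewrite -subr_eq0 -mul_scalar_mx -mulmxBl mulmxA.
  by rewrite -[_ *m (_ - _)]/(_ * _) CH' mul0mx.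
apply: has_value_of_orbits => j jk.
set w := convergent_vec _ _ _.
have [lpm|lpm] := eqVneq lp lm.
  have [Nw|Nw] := eqVneq ((Emx b a - lm%:M) *m w) 0.
    have Ew : Emx b a *m w = lp *: w.
      by move/eqP: Nw; rewrite mulmxBl mul_scalar_mx subr_eq0 -lpm => /eqP.
    exists w; split; [exact: convergent_vec_neq0| |exact: orbit_eigen_tends_to Ew].
    by apply: betaE Ew; exact: convergent_vec_neq0.
  exists ((Emx b a - lm%:M) *m w); split => //; first exact: betaE.
  apply: orbit_parabolic => //; last exact: complex_harmonic.
  by rewrite -{2}lpm.
(* Equal moduli would both be 1, and distinct unimodular eigenvalues fall under (3). *)
have ltm : `|lm| < `|lp|.
  rewrite lt_neqAle (le_trans lm1 lp1) andbT; apply/negP => /eqP eqn; apply: nell.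
  have lm1' : `|lm| = 1.
    by apply/eqP; rewrite -(@pexpr_eq1 _ _ 2) // expr2 {1}eqn lpm1.
  rewrite -trE; apply: unimodular_trace_bound => //.
  - by rewrite -exprM mulnC exprM sqrrN !expr1n.
  - by rewrite detE det_Emx.
  - by rewrite -eqn.
(* Otherwise [w] is an eigenvector for [lm], and the period from [j] is triangular with lower right
   entry [lp], which is (2). *)
have Nw : (Emx b a - lm%:M) *m w != 0.
  apply/eqP => Nw; apply: nper; exists j.
  have Ew : Emx b a *m w = lm *: w.
    by move/eqP: Nw; rewrite mulmxBl mul_scalar_mx subr_eq0 => /eqP.
  have [A10 A00] := (period_eigen b a j lm).1 Ew.
  have A11 : Mmx (period_from a j) 1 1 = lp.
    have := period_trace b a j; rewrite mxtrace2 A00 -trE (addrC lp).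
    exact: addrI.
  split=> //; rewrite A11 lt_neqAle lp1 andbT eq_sym.
  apply: contraTneq ltm => e; move: lpm1; rewrite e mul1r => ->.
  by rewrite ltxx.
exists ((Emx b a - lm%:M) *m w); split => //; first exact: betaE.
apply: (orbit_dominant _ CH lp0 lpm); apply: complex_geometric.
by rewrite normf_div ltr_pdivrMr ?mul1r ?normr_gt0.
Qed.

End Values.

Theorem theorem4p3 (R : realType) (N k : nat) (hk : (0 < k)%N)
    (b : N.-tuple R[i]) (a : k.-tuple R[i]) :
  ((exists v : P1 R, has_value b a v) <->
     [/\ ~ (Emx b a = ('i%C ^+ k)%:M \/ Emx b a = (- ('i%C ^+ k))%:M),
         ~ (exists j : nat, [/\ (j < k)%N,
              Mmx (period_from a j) 1 0 = 0 &
              1 < `|Mmx (period_from a j) 1 1|]) &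
         ~ (\tr (Emx b a) ^+ 2 \is Num.real /\
              0 <= (-1) ^+ k * \tr (Emx b a) ^+ 2 < 4)]) /\
  (forall v : P1 R, has_value b a v ->
     forall lp lm : R[i], eigenvalue_labelling (Emx b a) lp lm ->
       v = beta (Emx b a) lp).
Proof.
have ak : size a = k := size_tuple a.
have a0 : (0 < size a)%N by rewrite ak.
have nec v : has_value b a v ->
    [/\ ~ (exists c, Emx b a = c%:M),
        ~ (exists j : nat, [/\ (j < size a)%N, Mmx (period_from a j) 1 0 = 0 &
              1 < `|Mmx (period_from a j) 1 1|]) &
        ~ (\tr (Emx b a) ^+ 2 \is Num.real /\
              0 <= (-1) ^+ size a * \tr (Emx b a) ^+ 2 < 4)].
  move=> cv; split.
  - by move=> [c]; exact: has_value_not_scalar cv.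
  - by move=> [j [_ A10]]; exact: has_value_period_mx cv A10.
  - by move=> [_]; exact: has_value_not_elliptic cv.
split; last first.
  (* Convergence rules out the three conditions, so [beta] is a value as well; the two limits are
     compared along the orbit with offset 0. *)
  move=> v cv lp lm lab; have [n1 n2 n3] := nec v cv.
  have cv' := has_value_beta a0 lab n1 n2 n3.
  have [p p0 vp] := P1_ratio_surj v.
  have [q q0 bq] := P1_ratio_surj (beta (Emx b a) lp).
  rewrite vp in cv; rewrite bq in cv'; rewrite vp bq.
  apply/P1_ratio_eq => //.
  exact: proj_tends_to_collinear (has_value_orbit a0 0 p0 cv)
    (has_value_orbit a0 0 q0 cv').
rewrite ak in nec.
split=> [[v /nec[n1 n2 n3]]|[n1 n2 n3]].
  by split=> // -[] E; apply: n1; [exists ('i%C ^+ k)|exists (- 'i%C ^+ k)].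
have [|lp [lm lab]] := @eigenvalue_labelling_exists _ (Emx b a).
  by rewrite det_Emx normrX normrN1 expr1n.
have := has_value_beta a0 lab; rewrite ak => beta_value.
exists (beta (Emx b a) lp); apply: beta_value => // -[c /scalar_Emx].
by rewrite ak.
Qed.
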